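(* Let $k\ge 4$ be an even integer and let $G$ be a finite group of even order. Assume that every prime power dividing $|G|$ either divides $k$ or is relatively prime to $k(k-1)$. Then there are infinitely many integers $v$ for which there exists a $2$-$(v,k,1)$-design whose automorphism group has a subgroup isomorphic to $G$.
   Context: A $2$-$(v,k,1)$-design consists of a set of $v$ points together with a collection of $k$-element subsets of the points (called blocks) such that any two distinct points lie in exactly one block. An automorphism is a permutation of the points mapping the set of blocks onto itself. *)

(* Defs.v *)
From mathcomp Require Import all_boot all_fingroup.

Set Implicit Arguments.
Unset Strict Implicit.
Unset Printing Implicit Defensive.

Import GroupScope.

Section Design.

Variable T : finType.
Implicit Type B : {set {set T}}.

(* Blocks form a set, not a multiset: for k >= 2 the uniqueness clause leaves
   no room for repeated blocks. *)
Definition is_design (v k : nat) B : Prop :=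
  [/\ #|T| = v,
      forall b : {set T}, b \in B -> #|b| = k
    & forall x y : T, x != y ->
        exists! b : {set T}, [/\ b \in B, x \in b & y \in b]].

Definition design_aut B : {set {perm T}} :=
  [set s : {perm T} | [set s @: b | b : {set T} in B] == B].

Lemma design_autE B : design_aut B = 'N(B | 'P^*).
Proof.
apply/setP=> s; rewrite inE.
have -> : [set s @: b | b : {set T} in B] = ('P^*^*)%act B s by [].
apply/eqP/idP => [sB|/astabs_setact //].
by rewrite -astab1_set; apply/astab1P.
Qed.

Lemma design_aut_group_set B : group_set (design_aut B).
Proof. by rewrite design_autE groupP. Qed.

Canonical design_aut_group B := Group (design_aut_group_set B).

End Design.

(* Main.v *)
Require Import Defs.
From mathcomp Require Import all_boot all_fingroup.
From mathcomp Require Import all_order all_algebra all_solvable all_field.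
From mathcomp Require Import zify ring lra.

(** Write [k = 2h] and let [V] be the space of functions from the group to a
large finite field [F], with the group permuting coordinates and acting
trivially on a finite set [W]. The points are [W * V]. Since the action on [V]
is linear, the family of all blocks [{(x, s + a d) : (x, a) in Q}], for [s] in
[V] and [d] in an invariant set of directions, is invariant for every fixed
pattern [Q] in [W * F]; the directions are cut out by an invariant "class" of
a vector in the units of [F] modulo [r]-th powers, which exists as soon as [F]
has enough roots of unity. Involutions force the block through [(x, u)] and [(x, -u)] to be
symmetric, so those pairs are covered by patterns [{(x, a_x), (x, -a_x)}] with
[x] in a block of a [2-(w, h, 1)] design on [W]. Such a pattern covers two of
the [r] classes of differences of a pair [x <> y]; the other [r - 2] classes
are covered by graphs [{(x, a_x)}] over the blocks of a [2-(w, k, 1)] design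
on [W], which also fills the sets [W * {u}].

All patterns, and the two designs on [W], only require elements of [F] whose
mutual differences lie in prescribed cyclotomic classes; these exist for large
[F] by an elementary second moment argument. *)

Set Implicit Arguments.
Unset Strict Implicit.
Unset Printing Implicit Defensive.

Import GRing.Theory Order.TTheory Num.Theory.
Open Scope ring_scope.

(** * Finite fields and cyclotomic classes *)

Lemma finField_exists (m n : nat) : (0 < m)%N ->
  exists F : finFieldType, (n < #|F|)%N /\ (m %| #|F|.-1)%N.
Proof.
move=> m_gt0; have [p p_gt p_pr] := prime_above m.
have tm_gt0 : (0 < totient m * n.+1)%N by rewrite muln_gt0 totient_gt0 m_gt0.
have [F _ cF] := pPrimePowerField p_pr tm_gt0.
have p_gt1 := prime_gt1 p_pr.
exists F; rewrite cF; split.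
  apply: leq_ltn_trans (ltn_expl _ p_gt1).
  by apply: leq_trans (leqnSn n) _; rewrite leq_pmull ?totient_gt0.
have co : coprime p m.
  by rewrite prime_coprime //; apply/negP => /dvdn_leq; lia.
rewrite -subn1 -eqn_mod_dvd ?expn_gt0 ?(ltnW p_gt1) //.
by rewrite expnM -modnXm (Euler_exp_totient co) modnXm exp1n.
Qed.

Lemma finField_expfE (F : finFieldType) (x : F) : x != 0 -> x ^+ #|F|.-1 = 1.
Proof.
move=> x0; apply: (mulfI x0).
by rewrite -exprS prednK ?expf_card ?mulr1 // ltnW ?finNzRing_gt1.
Qed.

Lemma finField_pred_gt0 (F : finFieldType) : (0 < #|F|.-1)%N.
Proof. by have := finNzRing_gt1 F; case: #|F| => [|[]]. Qed.

Lemma finField_factors_gt0 (F : finFieldType) N e :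
  (N * e)%N = #|F|.-1 -> (0 < N)%N /\ (0 < e)%N.
Proof.
by move=> Ne; have := finField_pred_gt0 F; rewrite -Ne muln_gt0 => /andP.
Qed.

Lemma finField_prim_root (F : finFieldType) :
  exists g : F, (#|F|.-1).-primitive_root g.
Proof.
pose rs := enum (predC1 (0 : F)).
have sz : size rs = #|F|.-1 by rewrite -(cardC1 (0 : F)) cardE.
have /hasP[g _ gP] : has (#|F|.-1).-primitive_root rs; last by exists g.
apply: has_prim_root; rewrite ?sz ?enum_uniq ?finField_pred_gt0 //.
apply/allP => x; rewrite mem_enum => x0.
by rewrite unity_rootE finField_expfE.
Qed.

Lemma finField_prim_root_div (F : finFieldType) N e : (N * e)%N = #|F|.-1 ->
  exists w : F, e.-primitive_root w.
Proof.
move=> Ne; have [g gP] := finField_prim_root F; exists (g ^+ N).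
have [_ e_gt0] := finField_factors_gt0 Ne.
have -> : e = (#|F|.-1 %/ gcdn N #|F|.-1)%N.
  by rewrite -Ne gcdnMr mulKn // -(ltn_pmul2r e_gt0) Ne (prim_order_gt0 gP).
exact: exp_prim_root.
Qed.

Lemma prim_root_neq0 (F : fieldType) n (w : F) : n.-primitive_root w -> w != 0.
Proof.
move=> wP; apply/eqP=> w0; have /eqP := prim_expr_order wP.
by rewrite w0 expr0n gtn_eqF ?(prim_order_gt0 wP) // eq_sym oner_eq0.
Qed.

Lemma card_unity_roots (F : finFieldType) (N : nat) : (0 < N)%N ->
  (#|[set z : F | z ^+ N == 1%R]| <= N)%N.
Proof.
move=> N_gt0; rewrite cardE; apply: max_unity_roots => //; last exact: enum_uniq.
by apply/allP => x; rewrite mem_enum inE unity_rootE.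
Qed.

(* [a |-> (u - a) / (v - a)] is injective and maps the set to the [N]-th roots
   of unity other than 1. *)
Lemma class_pairs_count (F : finFieldType) (N : nat) (u v : F) : (0 < N)%N ->
  u != v ->
  (#|[set a | [&& u != a, v != a & (u - a) ^+ N == (v - a) ^+ N]]| <= N.-1)%N.
Proof.
move=> N_gt0 uv; set A := [set a | _].
pose f a := (u - a) / (v - a).
have f_inj : {in A &, injective f}.
  move=> a b; rewrite !inE => /and3P[ua va _] /and3P[ub vb _] /eqP.
  rewrite /f eqr_div ?subr_eq0 // => /eqP E.
  have : (u - v) * (a - b) = 0.
    have -> : (u - v) * (a - b) = (u - a) * (v - b) - (u - b) * (v - a) by ring.
    by rewrite E subrr.
  by move/eqP; rewrite mulf_eq0 !subr_eq0 (negPf uv) => /eqP.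
rewrite -(card_in_imset f_inj) -ltnS prednK //.
apply: leq_trans _ (card_unity_roots F N_gt0).
apply/proper_card/properP; split.
  apply/subsetP => _ /imsetP[a + ->]; rewrite !inE => /and3P[ua va /eqP E].
  by rewrite expr_div_n E divff // expf_neq0 // subr_eq0.
exists 1; first by rewrite inE expr1n.
apply/imsetP => -[a]; rewrite !inE => /and3P[_ va _] E.
have : 1 * (v - a) = u - a by rewrite E divfK // subr_eq0.
by rewrite mul1r => /addIr vu; rewrite vu eqxx in uv.
Qed.

Definition class_count (F : finFieldType) (U : {set F}) N (a z : F) : nat :=
  #|[set u in U | (u - a) ^+ N == z]|.

(** * Prescribed classes of differences *)

Lemma class_count_sum (F : finFieldType) (U : {set F}) N e (a : F) :
  (N * e)%N = #|F|.-1 ->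
  (#|U| <= (\sum_(z : F | z ^+ e == 1%R) class_count U N a z).+1)%N.
Proof.
move=> Ne.
rewrite (cardsD1 a U) -addn1 addnC leq_add ?leq_b1 //.
rewrite -sum1_card (partition_big (fun u => (u - a) ^+ N) (fun z => z ^+ e == 1)).
  apply: leq_sum => z _; rewrite sum1_card; apply/subset_leq_card/subsetP => u.
  by rewrite -topredE /= !inE => /andP[/andP[_ ->] ->].
move=> u; rewrite !inE => /andP[ua _]; rewrite -exprM Ne.
by rewrite finField_expfE // subr_eq0.
Qed.

Lemma class_count_sqr_sum (F : finFieldType) (U : {set F}) N e :
  (N * e)%N = #|F|.-1 ->
  (\sum_(a : F) \sum_(z : F | z ^+ e == 1%R) class_count U N a z ^ 2
     <= #|U| * #|F|.-1 + #|U| * #|U|.-1 * N.-1)%N.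
Proof.
move=> Ne; have [N_gt0 e_gt0] := finField_factors_gt0 Ne.
pose P (u v a : F) := [&& u != a, v != a & (u - a) ^+ N == (v - a) ^+ N].
have step a : (\sum_(z : F | z ^+ e == 1%R) class_count U N a z ^ 2 <=
    \sum_(u in U) \sum_(v in U) P u v a)%N.
  pose D z u := (u - a) ^+ N == z.
  have -> : (\sum_(z : F | z ^+ e == 1%R) class_count U N a z ^ 2 =
     \sum_(u in U) \sum_(v in U) \sum_(z : F | z ^+ e == 1%R) (D z u && D z v))%N.
    transitivity (\sum_(u in U) \sum_(z : F | z ^+ e == 1%R)
        \sum_(v in U) (D z u && D z v))%N; last first.
      by apply: eq_bigr => u _; rewrite exchange_big.
    rewrite exchange_big; apply: eq_bigr => z _.
    have E : class_count U N a z = (\sum_(u in U) D z u)%N.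
      rewrite /class_count -sum1_card big_mkcond [RHS]big_mkcond.
      by apply: eq_bigr => u _; rewrite inE; case: (u \in U).
    rewrite expnS expn1 {1}E big_distrl; apply: eq_bigr => u _.
    by rewrite E big_distrr; apply: eq_bigr => v _ /=; rewrite mulnb.
  apply: leq_sum => u _; apply: leq_sum => v _.
  apply: leq_trans (_ : \sum_(z | z == (u - a) ^+ N) P u v a <= _)%N; last first.
    by rewrite big_pred1_eq.
  rewrite big_mkcond [leqRHS]big_mkcond; apply: leq_sum => z _.
  case: ifP => // /eqP ze; rewrite /D [z == _]eq_sym.
  case: ifP => [/eqP Ez|_] //=; case: eqP => //= Ev.
  have z0 : z != 0.
    by apply: contra_eq_neq ze => ->; rewrite expr0n gtn_eqF // eq_sym oner_neq0.
  rewrite /P Ez Ev eqxx andbT.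
  have pow0 x : (x - a) ^+ N = z -> x != a.
    by move=> xz; apply: contraNneq z0 => xa; rewrite -xz xa subrr expr0n gtn_eqF.
  by rewrite !pow0.
apply: (@leq_trans (\sum_a \sum_(u in U) \sum_(v in U) P u v a)%N).
  by apply: leq_sum => a _; exact: step.
rewrite exchange_big -mulnA -mulnDr -sum_nat_const /=.
apply: leq_sum => u uU; rewrite exchange_big (bigD1 u) //=.
have card_sum v : (\sum_a P u v a = #|[set a | P u v a]|)%N.
  by rewrite -sum1_card [RHS]big_mkcond; apply: eq_bigr => a _; rewrite inE; case: (P _ _ _).
apply: leq_add.
  rewrite card_sum -(cardC1 u); apply/subset_leq_card/subsetP => a.
  by rewrite !inE eq_sym => /and3P[].
have -> : #|U|.-1 = #|U :\ u| by rewrite [in LHS](cardsD1 u) uU.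
rewrite -sum_nat_const [leqLHS](eq_bigl (fun v => v \in U :\ u)); last first.
  by move=> v; rewrite !inE andbC.
apply: leq_sum => v; rewrite !inE eq_sym card_sum => /andP[uv _].
exact: class_pairs_count.
Qed.

Lemma variance_bound (N e m q s1 s2 c : int) :
  N * e = q - 1 -> 1 <= e -> 1 <= m -> 1 <= q -> c <= e ->
  s2 <= m * (q - 1) + m * (m - 1) * (N - 1) -> q * m - q <= s1 ->
  e ^+ 2 * s2 - 2 * e * m * s1 + q * c * m ^+ 2 <= 3 * e ^+ 2 * q * m.
Proof.
move=> Ne e1 m1 q1 ce hs2 hs1.
have e0 : 0 <= e by lra.
have m0 : 0 <= m by lra.
have q0 : 0 <= q by lra.
have h1 : 0 <= e ^+ 2 * (m * (q - 1) + m * (m - 1) * (N - 1) - s2).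
  by rewrite mulr_ge0 ?sqr_ge0 ?subr_ge0.
have h2 : 0 <= 2 * e * m * (s1 - (q * m - q)).
  by rewrite mulr_ge0 ?subr_ge0 // !mulr_ge0.
have h3 : 0 <= q * m ^+ 2 * (e - c).
  by rewrite mulr_ge0 ?subr_ge0 // mulr_ge0 ?sqr_ge0.
have h4 : 0 <= e * q * m * (e - 1).
  by rewrite mulr_ge0 ?subr_ge0 // !mulr_ge0.
have h5 : 0 <= e ^+ 2 * m * (m - 1).
  by rewrite mulr_ge0 ?subr_ge0 // mulr_ge0 ?sqr_ge0.
have h6 : 0 <= e * m * (m - 1) by rewrite mulr_ge0 ?subr_ge0 // !mulr_ge0.
have h7 : 0 <= e ^+ 2 * m by rewrite mulr_ge0 ?sqr_ge0.
have E : e ^+ 2 * (m * (m - 1) * (N - 1)) =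
  e * (m * (m - 1)) * (q - 1) - e ^+ 2 * m * (m - 1) by rewrite -Ne; ring.
nra.
Qed.

(* Chebyshev's inequality: [class_count U N a z] has mean about [#|U| / e] over
   [a] and [z], and the number of pairs in the same class bounds its variance. *)
Lemma card_few_class (F : finFieldType) (U : {set F}) N e (z : F) :
  (N * e)%N = #|F|.-1 -> z ^+ e = 1 ->
  (#|[set a | (2 * e * class_count U N a z < #|U|)%N]| * #|U|
     <= 12 * e ^ 2 * #|F|)%N.
Proof.
move=> Ne ze; set bad := [set a | _].
have F_gt1 : (1 < #|F|)%N := finNzRing_gt1 F.
have [N_gt0 e_gt0] := finField_factors_gt0 Ne.
have [U0|m_gt0] := posnP #|U|; first by rewrite U0 muln0.
pose n a z := class_count U N a z.
set m := #|U|; set q := #|F|.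
pose S2 := (\sum_a \sum_(z : F | z ^+ e == 1%R) n a z ^ 2)%N.
pose S1 := (\sum_a \sum_(z : F | z ^+ e == 1%R) n a z)%N.
pose c := #|[set z : F | z ^+ e == 1%R]|.
have S2_le : (S2 <= m * q.-1 + m * m.-1 * N.-1)%N by exact: class_count_sqr_sum.
have S1_ge : (q * m <= S1 + q)%N.
  rewrite /q -{2}(muln1 #|F|) -!sum_nat_const -big_split; apply: leq_sum => a _ /=.
  by rewrite addn1; apply: class_count_sum.
have c_le : (c <= e)%N by exact: card_unity_roots.
pose T : int := \sum_a \sum_(z : F | z ^+ e == 1%R) (e%:Z * (n a z)%:Z - m%:Z) ^+ 2.
have TE : T = e%:Z ^+ 2 * S2%:Z - 2 * e%:Z * m%:Z * S1%:Z + q%:Z * c%:Z * m%:Z ^+ 2.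
  have -> : q%:Z * c%:Z * m%:Z ^+ 2 = \sum_(a : F) \sum_(z : F | z ^+ e == 1%R) m%:Z ^+ 2.
    have const : \sum_(z : F | z ^+ e == 1%R) m%:Z ^+ 2 = m%:Z ^+ 2 *+ c.
      by rewrite -sumr_const; apply: eq_bigl => y; rewrite inE.
    by rewrite const sumr_const -mulrnA -mulr_natl natz PoszM [(c%:Z * _)%R]mulrC.
  rewrite /S2 /S1 !(big_morph Posz PoszD (erefl _)) !mulr_sumr -sumrN -!big_split /=.
  apply: eq_bigr => a _.
  rewrite !(big_morph Posz PoszD (erefl _)) !mulr_sumr -sumrN -!big_split /=.
  apply: eq_bigr => y _; rewrite sqrrB -mulnn PoszM; ring.
have T_ge : #|bad|%:Z * m%:Z ^+ 2 <= 4 * T.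
  rewrite /T (bigID (fun a => a \in bad)) /= mulrDr -[leLHS]addr0 lerD //; last first.
    by rewrite mulr_ge0 // sumr_ge0 // => a _; rewrite sumr_ge0 // => y _; rewrite sqr_ge0.
  rewrite mulr_sumr -natz mulr_natl -sumr_const; apply: ler_sum => a.
  rewrite inE => abad; rewrite (bigD1 z) ?ze //= mulrDr -[leLHS]addr0 lerD //.
    have : 2 * (e%:Z * (n a z)%:Z) <= m%:Z.
      by rewrite -!PoszM lez_nat mulnA ltnW.
    have : 0 <= e%:Z * (n a z)%:Z by rewrite -PoszM.
    by move: (_ * _) (m%:Z) => x y; nra.
  by rewrite mulr_ge0 // sumr_ge0 // => y _; rewrite sqr_ge0.
have bad_le : #|bad|%:Z * m%:Z ^+ 2 <= 4 * (3 * e%:Z ^+ 2 * q%:Z * m%:Z).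
  apply: le_trans T_ge _; rewrite TE ler_pM2l //.
  have predZ (x : nat) : (0 < x)%N -> x.-1%:Z = x%:Z - 1.
    by case: x => // x _; lia.
  apply: (@variance_bound N%:Z) => //.
  - by rewrite -PoszM Ne predZ // ltnW.
  - by rewrite lez_nat ltnW.
  - by move: S2_le; rewrite -lez_nat PoszD !PoszM !predZ // ltnW.
  - by rewrite lerBlDr -PoszM -PoszD lez_nat.
rewrite -(leq_pmul2r m_gt0) -lez_nat !PoszM -mulrA -expr2.
apply: le_trans bad_le _; rewrite -!PoszM lez_nat.
by rewrite !mulnA.
Qed.

(* The elements are chosen greedily, avoiding those [a] for which some remaining
   candidate set shrinks by more than a factor [2 e]. *)
Lemma prescribed_differences (F : finFieldType) N e D n (U : nat -> {set F})
    (c : nat -> nat -> F) :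
  (N * e)%N = #|F|.-1 -> (12 * e ^ 2 * n <= D)%N ->
  (forall i, (i < n)%N -> (D * (4 * e ^ 2) ^ n * #|F| < #|U i| ^ 2)%N) ->
  (forall i j, (i < j < n)%N -> c i j ^+ e = 1) ->
  exists a : nat -> F, (forall i, (i < n)%N -> a i \in U i) /\
    forall i j, (i < j < n)%N -> (a j - a i) ^+ N = c i j.
Proof.
move=> Ne; have [N_gt0 e_gt0] := finField_factors_gt0 Ne.
elim: n U c => [|n IHn] U c hD hU hc.
  by exists (fun _ => 0); split=> [i|i j]; rewrite ?ltn0 ?andbF.
pose bad j := [set a | (2 * e * class_count (U j) N a (c 0%N j) < #|U j|)%N].
set D' := (D * (4 * e ^ 2) ^ n.+1)%N in hU.
have hD' : (12 * e ^ 2 * n <= D')%N.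
  apply: leq_trans (leq_pmulr _ _); last by rewrite expn_gt0 muln_gt0 expn_gt0 e_gt0.
  by apply: leq_trans hD; rewrite leq_mul2l leqnSn orbT.
have small_bad j : (0 < j < n.+1)%N -> (n * #|bad j| < #|U 0%N|)%N.
  move=> j_n; have /andP[j0 jn] := j_n.
  have b_le := card_few_class (U j) Ne (hc 0%N j j_n).
  have hUj := hU j jn; have hU0 := hU 0%N isT.
  have Uj_gt0 : (0 < #|U j|)%N by case: #|U j| hUj; rewrite ?exp0n.
  rewrite -(ltn_pmul2r Uj_gt0); apply: leq_ltn_trans (_ : D' * #|F| < _)%N.
    rewrite -mulnA; apply: leq_trans (leq_mul (leqnn n) b_le) _.
    by rewrite mulnA leq_mul2r [(n * _)%N]mulnC hD' orbT.
  rewrite -ltn_sqr -[X in (X < _)%N]mulnn expnMn; exact: ltn_mul.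
have [a aU a_good] : exists2 a, a \in U 0%N &
    forall j, (0 < j < n.+1)%N -> a \notin bad j.
  have [n0|n_gt0] := posnP n.
    have := hU 0%N isT; have [->|[a aU] _] := set_0Vmem (U 0%N); first by rewrite cards0.
    by exists a => // j; rewrite n0; case: j => // j.
  pose B := \bigcup_(j < n) bad j.+1.
  have BU : (#|B| < #|U 0%N|)%N.
    have B_le : (#|B| <= \sum_(j < n) #|bad j.+1|)%N.
      by apply: (big_ind2 (fun (X : {set F}) m => #|X| <= m)%N);
        rewrite ?cards0 // => X m Y p Xm Yp; rewrite (leq_trans (leq_card_setU _ _)) ?leq_add.
    have U0_gt0 : (0 < #|U 0%N|)%N by apply: leq_ltn_trans (small_bad 1%N _).
    apply: leq_ltn_trans B_le _; rewrite -(ltn_pmul2l n_gt0) big_distrr /=.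
    apply: leq_ltn_trans (_ : _ <= \sum_(j < n) #|U 0%N|.-1)%N _.
      apply: leq_sum => j _; rewrite -ltnS prednK //.
      by apply: small_bad; rewrite ltnS; exact: ltn_ord.
    by rewrite sum_nat_const card_ord ltn_pmul2l // prednK.
  have : ~~ (U 0%N \subset B) by apply: contraL BU => /subset_leq_card; rewrite leqNgt.
  case/subsetPn=> a aU aB; exists a => // -[|j] // jn.
  by apply: contra aB => ab; apply/bigcupP; exists (Ordinal (jn : (j < n)%N)).
pose U' j := [set u in U j.+1 | (u - a) ^+ N == c 0%N j.+1].
have [|||a' [a'U a'c]] := IHn U' (fun i j => c i.+1 j.+1).
- by apply: leq_trans hD; rewrite leq_mul2l leqnSn orbT.
- move=> i i_n; have := a_good i.+1 i_n; rewrite inE -leqNgt -/(U' i) => U'_ge.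
  have hUi := hU i.+1 i_n; rewrite -(ltn_pmul2l (_ : 0 < 4 * e ^ 2)%N); last first.
    by rewrite muln_gt0 expn_gt0 e_gt0.
  apply: leq_trans (_ : #|U i.+1| ^ 2 <= _)%N; last first.
    by rewrite -[4%N]/(2 ^ 2)%N -!expnMn leq_sqr.
  apply: leq_ltn_trans hUi.
  by rewrite /D' [(_ ^ n.+1)%N]expnS mulnA [(4 * e ^ 2 * (D * _))%N]mulnCA.
- by move=> i j ij; apply: hc.
exists (fun i => if i is i'.+1 then a' i' else a); split=> [[|i] //= i_n|].
  by have := a'U i i_n; rewrite inE => /andP[].
by case=> [|i] [|j] //= ij; [have := a'U j ij; rewrite inE => /andP[_ /eqP] | exact: a'c].
Qed.

Lemma prescribed_classes (e n : nat) : (0 < e)%N -> exists Q : nat,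
  forall (F : finFieldType) (N : nat) (W : finType) (K : {set W})
    (U : W -> {set F}) (c : W -> W -> F),
  (Q < #|F|)%N -> (N * e)%N = #|F|.-1 -> ~~ odd N -> (#|K| <= n)%N ->
  (forall x, x \in K -> (N <= #|U x|)%N) ->
  (forall x y, x \in K -> y \in K -> x != y -> c x y ^+ e = 1) ->
  (forall x y, c x y = c y x) ->
  exists a : W -> F, (forall x, x \in K -> a x \in U x) /\
    forall x y, x \in K -> y \in K -> x != y -> (a x - a y) ^+ N = c x y.
Proof.
move=> e_gt0; set D := (12 * e ^ 2 * n)%N; exists (D * (4 * e ^ 2) ^ n.+1)%N.
move=> F N W K U c Q_lt Ne N_even K_n U_ge c_unit c_sym.
have F_gt1 : (1 < #|F|)%N := finNzRing_gt1 F.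
have [N_gt0 _] := finField_factors_gt0 Ne.
have [->|[x0 _]] := set_0Vmem K.
  by exists (fun=> 0); split=> [x|x y]; rewrite inE.
pose s := enum K; have sE : size s = #|K| by rewrite cardE.
have memK i : (i < #|K|)%N -> nth x0 s i \in K.
  by rewrite -sE => i_s; rewrite -mem_enum mem_nth.
have e2_gt0 : (0 < 4 * e ^ 2)%N by rewrite muln_gt0 expn_gt0 e_gt0.
have N_big : (D * (4 * e ^ 2) ^ #|K| * #|F| < N ^ 2)%N.
  rewrite -(ltn_pmul2l e2_gt0).
  apply: leq_trans (_ : #|F| ^ 2 <= _)%N; last first.
    rewrite -[4%N]/(2 ^ 2)%N -!expnMn leq_sqr; lia.
  rewrite -mulnn mulnA ltn_pmul2r ?(ltnW F_gt1) //.
  rewrite mulnCA -expnS; apply: leq_ltn_trans Q_lt.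
  by rewrite leq_mul2l leq_pexp2l ?orbT.
have [||| a [aU ac]] := @prescribed_differences F N e D #|K| (fun i => U (nth x0 s i))
  (fun i j => c (nth x0 s i) (nth x0 s j)) Ne.
- by rewrite /D leq_mul2l K_n orbT.
- move=> i iK; apply: leq_trans N_big _; rewrite leq_sqr; exact/U_ge/memK.
- move=> i j /andP[ij jK]; have iK := ltn_trans ij jK.
  by apply: c_unit; rewrite ?memK // nth_uniq ?enum_uniq ?sE // ltn_eqF.
exists (fun x => a (index x s)).
have idx x : x \in K -> (index x s < #|K|)%N by move=> xK; rewrite -sE index_mem mem_enum.
have nidx x : x \in K -> nth x0 s (index x s) = x by move=> xK; rewrite nth_index ?mem_enum.
split=> [x xK|x y xK yK xy].
  by have := aU _ (idx x xK); rewrite nidx.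
wlog lt : x y xK yK xy / (index x s < index y s)%N => [wl|].
  have [||E] := ltngtP (index x s) (index y s); first exact: wl.
    by move=> lt; rewrite -opprB exprNn -signr_odd (negPf N_even) mul1r c_sym wl // eq_sym.
  by rewrite -(nidx x xK) -(nidx y yK) E eqxx in xy.
rewrite -opprB exprNn -signr_odd (negPf N_even) mul1r ac ?nidx //.
by rewrite lt idx.
Qed.

(** * Blowing up a design by a vector space *)

Definition pattern_block (F : finFieldType) (V : finLmodType F) (W : finType)
    (Q : {set W * F}) (s d : V) : {set W * V} :=
  [set (p.1, s + p.2 *: d) | p in Q].

Definition flat_block (V W : finType) (K : {set W}) (u : V) : {set W * V} :=
  [set (x, u) | x in K].

Definition blowup (F : finFieldType) (V : finLmodType F) (W : finType)
    (D : {set {set W}}) (PQ : {set {set W * F}}) (P : {set V}) :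
    {set {set W * V}} :=
  [set b | [exists K in D, exists u, b == flat_block K u]
        || [exists Q in PQ, exists s, exists d in P, b == pattern_block Q s d]].

Lemma blowupP (F : finFieldType) (V : finLmodType F) (W : finType)
    (D : {set {set W}}) (PQ : {set {set W * F}}) (P : {set V}) b :
  reflect ((exists2 K, K \in D & exists u, b = flat_block K u) \/
           (exists Q s d, [/\ Q \in PQ, d \in P & b = pattern_block Q s d]))
          (b \in blowup D PQ P).
Proof.
rewrite inE; apply: (iffP orP) => -[].
- by case/existsP=> K /andP[KD /existsP[u /eqP->]]; left; exists K => //; exists u.
- case/existsP=> Q /andP[QP /existsP[s /existsP[d /andP[dP /eqP->]]]].
  by right; exists Q, s, d.
- by case=> K KD [u ->]; left; apply/existsP; exists K; rewrite KD; apply/existsP; exists u.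
case=> Q [s [d [QP dP ->]]]; right; apply/existsP; exists Q; rewrite QP /=.
by apply/existsP; exists s; apply/existsP; exists d; rewrite dP /=.
Qed.

Lemma mem_pattern_block (F : finFieldType) (V : finLmodType F) (W : finType)
    (Q : {set W * F}) (s d : V) x u :
  reflect (exists2 a, (x, a) \in Q & u = s + a *: d)
          ((x, u) \in pattern_block Q s d).
Proof.
apply: (iffP imsetP) => [[[y a] Qa [-> ->]]|[a Qa ->]]; first by exists a.
by exists (x, a).
Qed.

Lemma mem_flat_block (V W : finType) (K : {set W}) (u v : V) x :
  ((x, v) \in flat_block K u) = (x \in K) && (v == u).
Proof.
apply/imsetP/andP=> [[y yK [-> ->]] //|[xK /eqP->]]; by exists x.
Qed.

Lemma pattern_blockN (F : finFieldType) (V : finLmodType F) (W : finType)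
    (Q : {set W * F}) (s d : V) :
  (forall p, p \in Q -> (p.1, - p.2) \in Q) ->
  pattern_block Q s (- d) = pattern_block Q s d.
Proof.
move=> QN; apply/setP=> -[x u]; apply/mem_pattern_block/mem_pattern_block;
  by case=> a Qa ->; exists (- a); rewrite ?(QN _ Qa) // ?scaleNr ?scalerN // opprK.
Qed.

Lemma blowup_design (F : finFieldType) (V : finLmodType F) (W : finType) k
    (D : {set {set W}}) (PQ : {set {set W * F}}) (P : {set V}) :
  is_design #|W| k D -> 0 \notin P ->
  (forall Q, Q \in PQ -> #|Q| = k) ->
  (forall Q p p', Q \in PQ -> p \in Q -> p' \in Q -> p.2 = p'.2 -> p = p') ->
  (forall x y (de : V), de != 0 -> exists Q a b,
      [/\ Q \in PQ, (x, a) \in Q, (y, b) \in Q & (b - a)^-1 *: de \in P]) ->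
  (forall x y (de : V) Q a b Q' a' b', Q \in PQ -> Q' \in PQ ->
      (x, a) \in Q -> (y, b) \in Q -> (x, a') \in Q' -> (y, b') \in Q' ->
      (b - a)^-1 *: de \in P -> (b' - a')^-1 *: de \in P ->
      Q = Q' /\ ((a' = a /\ b' = b) \/
        [/\ a' = - a, b' = - b & forall p, p \in Q -> (p.1, - p.2) \in Q])) ->
  is_design (#|W| * #|V|) k (blowup D PQ P).
Proof.
move=> [_ Dk Duniq] P0 PQk PQinj ex uniq; split; first by rewrite card_prod.
  move=> _ /blowupP[[K KD [u ->]]|[Q [s [d [QP dP ->]]]]].
    by rewrite card_imset ?Dk // => x y [].
  rewrite card_in_imset ?PQk // => p p' pQ p'Q [_ /addrI /eqP].
  rewrite -subr_eq0 -scalerBl scaler_eq0 subr_eq0.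
  case/orP=> [/eqP|/eqP d0]; first exact: (PQinj Q).
  by rewrite d0 (negPf P0) in dP.
case=> x u [y w] xy.
have [uw|uw] := eqVneq u w.
  rewrite -{w}uw in xy *; have {}xy : x != y by apply: contraNneq xy => ->.
  have [K [[KD xK yK] Ku]] := Duniq x y xy.
  exists (flat_block K u); split.
    rewrite !mem_flat_block xK yK eqxx; split=> //.
    by apply/blowupP; left; exists K => //; exists u.
  move=> _ [/blowupP[[K' K'D [v ->]]|[Q [s [d [QP dP ->]]]]]].
    rewrite !mem_flat_block => /andP[xK' /eqP->] /andP[yK' _].
    by rewrite (Ku K').
  case/mem_pattern_block=> a Qa -> /mem_pattern_block[b Qb /addrI /eqP].
  rewrite -subr_eq0 -scalerBl scaler_eq0 subr_eq0.
  case/orP=> [/eqP ab|/eqP d0]; last by rewrite d0 (negPf P0) in dP.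
  by case: (PQinj Q _ _ QP Qa Qb ab) => /eqP; rewrite (negPf xy).
have de0 : w - u != 0 by rewrite subr_eq0 eq_sym.
have [Q [a [b [QP Qa Qb dP]]]] := ex x y _ de0.
set d := _ *: _ in dP.
have ba0 : b - a != 0.
  by apply: contraNneq P0 => ba; move: dP; rewrite /d ba invr0 scale0r.
have dE : w - u = (b - a) *: d by rewrite /d scalerA divff // scale1r.
exists (pattern_block Q (u - a *: d) d); split.
  split; first by apply/blowupP; right; exists Q, (u - a *: d), d.
    by apply/mem_pattern_block; exists a; rewrite ?subrK.
  apply/mem_pattern_block; exists b => //.
  by rewrite -addrA [- _ + _]addrC -scalerBl -dE addrC subrK.
move=> _ [/blowupP[[K' K'D [v ->]]|[Q' [s [d' [Q'P d'P ->]]]]]].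
  rewrite !mem_flat_block => /andP[_ /eqP uv] /andP[_ /eqP wv].
  by rewrite uv wv eqxx in uw.
case/mem_pattern_block=> a' Q'a uE /mem_pattern_block[b' Q'b wE].
have dE' : w - u = (b' - a') *: d' by rewrite uE wE opprD addrACA subrr add0r scalerBl.
have ba0' : b' - a' != 0.
  by apply: contraNneq de0 => ba; rewrite dE' ba scale0r.
have d'E : d' = (b' - a')^-1 *: (w - u) by rewrite dE' scalerA mulVf // scale1r.
have [||QQ' [[aa' bb']|[aa' bb' QN]]] := uniq x y (w - u) Q a b Q' a' b' QP Q'P Qa Qb Q'a Q'b.
- exact: dP.
- by rewrite -d'E.
- have d'd : d' = d by rewrite d'E aa' bb'.
  by rewrite -QQ' d'd uE aa' d'd addrK.
have d'd : d' = - d by rewrite d'E aa' bb' -opprD invrN scaleNr.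
by rewrite -QQ' d'd pattern_blockN // uE aa' d'd scaleNr scalerN opprK addrK.
Qed.

Lemma finField_oppr_neq (F : finFieldType) (x : F) :
  ~~ odd #|F|.-1 -> x != 0 -> - x != x.
Proof.
move=> q_even x0; have [g gP] := finField_prim_root F.
have q_gt0 := finField_pred_gt0 F.
rewrite eq_sym -subr_eq0 opprK -mulr2n -mulr_natl mulf_eq0 (negPf x0) orbF.
apply/negP => /eqP two0.
have neg1 : - 1 = 1 :> F.
  by apply/eqP; rewrite eq_sym -subr_eq0 opprK -[_ + _]/(2%:R) two0.
have : (g ^+ (#|F|.-1)./2) ^+ 2 == 1.
  by rewrite -exprM muln2 even_halfK // (prim_expr_order gP).
rewrite sqrf_eq1 neg1 orbb -(prim_order_dvd gP) gtnNdvd //; lia.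
Qed.

(* A difference family with one base block up to scaling; as [de] and [- de] are
   differences of the same pair, only one direction of each [{d, - d}] is kept,
   selected by comparing [enum_rank]. *)
Lemma exists_steiner k : (1 < k)%N -> exists Q : nat, forall F : finFieldType,
  (Q < #|F|)%N -> (k * k.-1 %| #|F|.-1)%N ->
  exists D : {set {set unit * F}}, is_design #|F| k D.
Proof.
move=> k_gt1; pose e := 'C(k, 2).
have e_gt0 : (0 < e)%N by rewrite bin_gt0.
have [Q hQ] := prescribed_classes k e_gt0; exists Q => F QF /dvdnP[N' qE].
pose N := (N' * 2)%N.
have Ne : (N * e)%N = #|F|.-1.
  by rewrite qE /N -mulnA [(2 * e)%N]mulnC -[2%N]/(2`!) bin_ffact ffactnS ffactn1.
have N_even : ~~ odd N by rewrite /N oddM andbF.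
have q_even : ~~ odd #|F|.-1 by rewrite -Ne oddM negb_and N_even.
have [w wP] := finField_prim_root_div Ne.
pose S := enum [set A : {set 'I_k} | #|A| == 2%N].
have S_size : size S = e by rewrite -cardE card_draws card_ord.
have memS A : (A \in S) = (#|A| == 2%N) by rewrite mem_enum inE.
pose c (i j : 'I_k) := w ^+ index [set i; j] S.
have [||||b [_ bc]] := hQ F N 'I_k setT (fun _ => setT) c QF Ne N_even.
- by rewrite cardsT card_ord.
- by move=> x _; rewrite cardsT; apply: leq_trans (leq_pred _); rewrite -Ne leq_pmulr.
- by move=> x y _ _ _; rewrite -exprM mulnC exprM (prim_expr_order wP) expr1n.
- by move=> x y; rewrite /c setUC.
have w0 := prim_root_neq0 wP.
have c0 i j : c i j != 0 by rewrite expf_neq0.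
have [N_gt0 _] := finField_factors_gt0 Ne.
have {}bc i j : i != j -> (b j - b i) ^+ N = c i j.
  by move=> ij; rewrite bc ?inE // 1?eq_sym // /c setUC.
have b_inj : injective b.
  move=> i j bij; apply/eqP; apply/idP; apply/negPn/negP => ij.
  by have := c0 i j; rewrite -bc // bij subrr expr0n gtn_eqF // eqxx.
pose P : {set F^o} := [set d : F | (d ^+ N == 1) && (enum_rank d < enum_rank (- d))%N].
pose PQ : {set {set unit * F}} := [set [set (tt, b i) | i : 'I_k]].
have D1 : is_design #|{: unit}| k (set0 : {set {set unit}}).
  by split=> [//|B|[] []//]; rewrite inE.
exists (blowup set0 PQ P).
have -> : #|F| = (#|{: unit}| * #|F|)%N by rewrite card_unit mul1n.
apply: (@blowup_design F F^o unit k) => //.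
- by rewrite inE expr0n gtn_eqF // eq_sym oner_eq0.
- by move=> _ /set1P->; rewrite card_imset ?card_ord // => i j [] /b_inj.
- by move=> _ [[] a] [[] a'] _ _ _ /= ->.
- move=> [] [] de de0.
  have deN : ((de : F) ^+ N) ^+ e = 1 by rewrite -exprM Ne finField_expfE.
  have [m deE] := prim_rootP wP deN.
  have : nth set0 S m \in S by rewrite mem_nth ?S_size.
  rewrite memS => /cards2P[i [j [ij Sm]]].
  have cij : c i j = de ^+ N.
    by rewrite deE /c -Sm index_uniq ?S_size ?enum_uniq.
  have bij : b j - b i != 0 by rewrite subr_eq0 (inj_eq b_inj) eq_sym.
  set t := (b j - b i)^-1 * de.
  have t0 : t != 0 by rewrite mulf_neq0 ?invr_eq0.
  have tN : t ^+ N = 1.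
    by rewrite exprMn exprVn bc // cij mulVf // -cij c0.
  have : enum_rank t != enum_rank (- t).
    by rewrite (inj_eq enum_rank_inj) eq_sym finField_oppr_neq.
  rewrite neq_ltn => /orP[lt|gt].
    exists [set (tt, b i) | i : 'I_k], (b i), (b j); split; rewrite ?set11 ?imset_f //.
    by rewrite inE tN eqxx.
  exists [set (tt, b i) | i : 'I_k], (b j), (b i); split; rewrite ?set11 ?imset_f //.
  have -> : (b i - b j)^-1 *: (de : F^o) = - t by rewrite -opprB invrN scaleNr.
  by rewrite inE opprK exprNn -signr_odd (negPf N_even) mul1r tN eqxx.
move=> [] [] de A a1 a2 A' a1' a2' /set1P-> /set1P->.
case/imsetP=> i _ [->] /imsetP[j _ [->]] /imsetP[i' _ [->]] /imsetP[j' _ [->]].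
have memP x y : (b y - b x)^-1 *: (de : F^o) \in P ->
    x != y /\ de ^+ N = c x y.
  move=> tP; have xy : x != y.
    apply: contraTneq tP => ->.
    by rewrite subrr invr0 scale0r inE expr0n gtn_eqF // eq_sym oner_eq0.
  split=> //; move: tP; rewrite inE exprMn exprVn bc // => /andP[/eqP E _].
  by rewrite -[RHS]mulr1 -E mulVKf.
move=> tP t'P; have [ij dij] := memP _ _ tP; have [ij' dij'] := memP _ _ t'P.
have inS x y : x != y -> [set x; y] \in S by move=> xy; rewrite memS cards2 xy.
have idx : index [set i; j] S = index [set i'; j'] S.
  apply/eqP; have := eq_prim_root_expr wP (index [set i; j] S) (index [set i'; j'] S).
  by rewrite -[_ ^+ _]/(c i j) -[X in _ == X]/(c i' j') -dij -dij' eqxx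
    !modn_small -?S_size ?index_mem ?inS // => /esym.
have sij : [set i; j] = [set i'; j'].
  by rewrite -(nth_index set0 (inS _ _ ij)) idx nth_index ?inS.
split=> //; left.
have : i \in [set i'; j'] by rewrite -sij set21.
have : j \in [set i'; j'] by rewrite -sij set22.
case/set2P=> ji /set2P[] ii; rewrite ?ii ?ji //.
- by rewrite ii ji eqxx in ij.
- move: tP t'P; rewrite ii ji => tP.
  have -> : (b j' - b i')^-1 *: (de : F^o) = - ((b i' - b j')^-1 *: (de : F^o)).
    by rewrite -[in LHS]opprB invrN scaleNr.
  move: tP; rewrite !inE opprK => /andP[_ lt] /andP[_ gt].
  by have := ltn_trans lt gt; rewrite ltnn.
by rewrite ii ji eqxx in ij.
Qed.

(** * The patterns *)

Lemma design_replication (W : finType) v k (D : {set {set W}}) x :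
  is_design v k D -> (#|[set A in D | x \in A]| * k.-1 = v.-1)%N.
Proof.
case=> <- Dk Duniq.
transitivity (\sum_(A in [set A in D | x \in A]) #|A :\ x|)%N.
  rewrite -sum_nat_const; apply: eq_bigr => A; rewrite inE => /andP[AD xA].
  by rewrite -(Dk A AD) (cardsD1 x A) xA.
transitivity (\sum_(A in [set A in D | x \in A]) \sum_(y | y != x) (y \in A))%N.
  apply: eq_bigr => A _; rewrite -sum1_card big_mkcond [RHS]big_mkcond.
  by apply: eq_bigr => y _; rewrite !inE; case: eqP => //=; case: (y \in A).
rewrite exchange_big -(cardC1 x) -sum1_card; apply: eq_bigr => y yx.
have xy : x != y by rewrite eq_sym.
have [A [[AD xA yA] Au]] := Duniq x y xy.
rewrite (bigD1 A) ?inE ?AD //= yA big1 // => B; rewrite inE => /andP[/andP[BD xB] BA].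
by apply/eqP; rewrite eqb0; apply: contra BA => yB; rewrite (Au B).
Qed.

Lemma prim_root_card (F : finFieldType) n (w : F) : n.-primitive_root w ->
  #|[set z : F | z ^+ n == 1]| = n.
Proof.
move=> wP; have n_gt0 := prim_order_gt0 wP.
apply/eqP; rewrite eqn_leq card_unity_roots //=.
have w_inj : injective (fun i : 'I_n => w ^+ i).
  move=> i j /eqP; rewrite (eq_prim_root_expr wP) !modn_small ?ltn_ord // => /eqP ij.
  exact: val_inj.
rewrite -[leqLHS]card_ord -(card_imset _ w_inj); apply/subset_leq_card/subsetP => _ /imsetP[i _ ->].
by rewrite inE -exprM mulnC exprM (prim_expr_order wP) expr1n.
Qed.

Lemma class_card (F : finFieldType) N e (y : F) : (N * e)%N = #|F|.-1 ->
  y ^+ e = 1 -> #|[set b : F | b ^+ N == y]| = N.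
Proof.
move=> Ne ye; have [g gP] := finField_prim_root F.
have [N_gt0 e_gt0] := finField_factors_gt0 Ne.
have wP : e.-primitive_root (g ^+ N).
  have -> : e = (#|F|.-1 %/ gcdn N #|F|.-1)%N by rewrite -Ne gcdnMr mulKn.
  exact: exp_prim_root.
have [i yE] := prim_rootP wP ye.
have g0 := prim_root_neq0 gP.
have [z zP] : exists z : F, N.-primitive_root z.
  by apply: (@finField_prim_root_div F e); rewrite mulnC.
rewrite -[RHS](prim_root_card zP).
have -> : [set b : F | b ^+ N == y] = [set g ^+ i * u | u in [set u | u ^+ N == 1]].
  apply/setP=> b; rewrite inE; apply/eqP/imsetP => [bN|[u + ->]].
    exists (g ^- i * b); last by rewrite mulVKf // expf_neq0.
    by rewrite inE exprMn exprVn bN yE -!exprM mulnC mulVf // expf_neq0.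
  by rewrite inE exprMn => /eqP->; rewrite mulr1 yE -!exprM mulnC.
by rewrite card_imset //; apply: mulfI; rewrite expf_neq0.
Qed.

(* With [b = a ^ 2], only the product of [a x - a x'] and [a x + a x'] needs a
   prescribed class: it is an odd class modulo [2 r], so as [r] is even the two
   factors differ modulo [r]. *)
Lemma exists_symmetric_pattern (r h : nat) : (0 < r)%N -> ~~ odd r ->
  exists Q0 : nat, forall (F : finFieldType) (N : nat) (W : finType)
    (A : {set W}) (y : W -> F),
  (Q0 < #|F|)%N -> (N * r)%N = #|F|.-1 -> (4 %| N)%N -> (#|A| <= h)%N ->
  (forall x, x \in A -> y x ^+ r = 1) ->
  exists a : W -> F, (forall x, x \in A -> a x ^+ N = y x) /\
    forall x x', x \in A -> x' \in A -> x != x' ->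
      [/\ a x - a x' != 0, a x + a x' != 0 & (a x - a x') ^+ N != (a x + a x') ^+ N].
Proof.
move=> r_gt0 r_even; have e_gt0 : (0 < 2 * r)%N by rewrite muln_gt0.
have [Q0 hQ] := prescribed_classes h e_gt0; exists Q0 => F N W A y QF Nr N4 Ah yr.
pose M := N./2.
have N_even : ~~ odd N by move: N4 => /dvdnP[t ->]; rewrite oddM andbF.
have M_even : ~~ odd M.
  rewrite /M; move: N4 => /dvdnP[t ->].
  by rewrite -[4%N]/(2 * 2)%N mulnA muln2 doubleK oddM andbF.
have NE : N = (M * 2)%N by rewrite muln2 even_halfK.
have Me : (M * (2 * r))%N = #|F|.-1 by rewrite mulnA -NE.
have [w wP] := finField_prim_root_div Me.
have [|||b [bU bc]] := hQ F M W A (fun x => [set b | b ^+ M == y x]) (fun _ _ => w) QF Me M_even Ah.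
- move=> x xA; rewrite (class_card Me) //.
  by rewrite mulnC exprM yr // expr1n.
- by move=> x x' _ _ _; rewrite prim_expr_order.
- by [].
have w0 := prim_root_neq0 wP.
have [g gP] := finField_prim_root F.
have [M_gt0 _] := finField_factors_gt0 Me.
have sqr x : exists a, x \in A -> a ^+ 2 = b x.
  have [xA|] := boolP (x \in A); last by exists 0.
  have bM : b x ^+ M = y x by have := bU x xA; rewrite inE => /eqP.
  have bq : b x ^+ #|F|.-1 = 1 by rewrite -Me exprM bM mulnC exprM yr // expr1n.
  have [[i /= _] bE] := prim_rootP gP bq.
  exists (g ^+ i./2) => _; rewrite -exprM muln2 even_halfK //.
  have : g ^+ (i * (M * r)) == 1 by rewrite exprM -bE exprM bM yr.
  rewrite -(prim_order_dvd gP) -Me mulnCA dvdn_pmul2r ?muln_gt0 ?M_gt0 //.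
  by rewrite dvdn2.
have [a aE] := fin_all_exists sqr.
have ab x x' : x \in A -> x' \in A -> (a x - a x') * (a x + a x') = b x - b x'.
  by move=> xA x'A; rewrite -subr_sqr !aE.
exists a; split=> [x xA|x x' xA x'A xx'].
  by rewrite NE mulnC exprM aE //; have := bU x xA; rewrite inE => /eqP.
have E : ((a x - a x') * (a x + a x')) ^+ M = w by rewrite ab // bc.
have nz : (a x - a x') * (a x + a x') != 0.
  by apply: contra_neq w0 => Z; rewrite -E Z expr0n gtn_eqF.
move: (nz); rewrite mulf_eq0 negb_or => /andP[n1 n2]; split=> //.
apply/negP => /eqP; rewrite NE !exprM => /eqP; rewrite eqf_sqr => sE.
have w_r : w ^+ r = ((a x + a x') ^+ M) ^+ (2 * r).
  rewrite -E exprMn; case/orP: sE => /eqP->; rewrite -?expr2 ?mulNr exprM //.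
  by rewrite exprNn -signr_odd (negPf r_even) mul1r expr2.
have /eqP : w ^+ r = 1 by rewrite w_r -exprM Me finField_expfE.
by rewrite -(prim_order_dvd wP) gtnNdvd // -[X in (X < _)%N]mul1n ltn_pmul2r.
Qed.

Definition sym_pattern (F : finFieldType) (W : finType) (A : {set W}) (a : W -> F) :
    {set W * F} :=
  [set (z.1, (-1) ^+ (z.2 : bool) * a z.1) | z in setX A setT].

Definition graph_pattern (F : finFieldType) (W : finType) (K : {set W}) (a : W -> F) :
    {set W * F} := [set (x, a x) | x in K].

Lemma mem_sym_pattern (F : finFieldType) (W : finType) (A : {set W}) (a : W -> F) x b :
  reflect (x \in A /\ exists s : bool, b = (-1) ^+ s * a x)
    ((x, b) \in sym_pattern A a).
Proof.
apply: (iffP imsetP) => [[[y s]]|[xA [s ->]]].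
  by rewrite inE => /andP[yA _] [-> ->]; split=> //; exists s.
by exists (x, s); rewrite // !inE xA.
Qed.

Lemma mem_graph_pattern (F : finFieldType) (W : finType) (K : {set W}) (a : W -> F) x b :
  reflect (x \in K /\ b = a x) ((x, b) \in graph_pattern K a).
Proof.
by apply: (iffP imsetP) => [[y yK [-> ->]]|[xK ->]] //; exists x.
Qed.

Lemma sym_pattern_opp (F : finFieldType) (W : finType) (A : {set W}) (a : W -> F) p :
  p \in sym_pattern A a -> (p.1, - p.2) \in sym_pattern A a.
Proof.
case: p => x b /mem_sym_pattern[xA [s ->]]; apply/mem_sym_pattern; split=> //.
by exists (~~ s); rewrite signrN mulNr.
Qed.

Lemma even_exprN (R : pzRingType) N (x : R) : ~~ odd N -> (- x) ^+ N = x ^+ N.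
Proof. by move=> N_even; rewrite exprNn -signr_odd (negPf N_even) mul1r. Qed.

Lemma signed_diff_expr (F : fieldType) N (s t : bool) (a b : F) : ~~ odd N ->
  ((-1) ^+ t * b - (-1) ^+ s * a) ^+ N =
  (if s == t then (a - b) ^+ N else (a + b) ^+ N).
Proof.
move=> N_even; case: s t => [] []; rewrite /= ?expr1 ?expr0 ?mulN1r ?mul1r ?opprK.
- by rewrite addrC.
- by rewrite addrC.
- by rewrite -opprD even_exprN // addrC.
- by rewrite -opprB even_exprN.
Qed.

Lemma exists_patterns (h r : nat) : (1 < h)%N -> (0 < r)%N -> ~~ odd r ->
  exists Q0 : nat, forall (F : finFieldType) (N : nat) (W : finType)
    (DK DH : {set {set W}}),
  (Q0 < #|F|)%N -> (N * r)%N = #|F|.-1 -> (4 %| N)%N ->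
  is_design #|W| h.*2 DK -> is_design #|W| h DH -> (r * h.-1 = #|W|.-1)%N ->
  exists PQ : {set {set W * F}},
  [/\ forall Q, Q \in PQ -> #|Q| = h.*2,
      forall Q p p', Q \in PQ -> p \in Q -> p' \in Q -> p.2 = p'.2 -> p = p',
      forall x y z, z ^+ r = 1 -> exists Q a b,
        [/\ Q \in PQ, (x, a) \in Q, (y, b) \in Q & (b - a) ^+ N = z]
    & forall x y Q a b Q' a' b', Q \in PQ -> Q' \in PQ ->
        (x, a) \in Q -> (y, b) \in Q -> (x, a') \in Q' -> (y, b') \in Q' ->
        (b - a) ^+ N = (b' - a') ^+ N -> b != a ->
        Q = Q' /\ ((a' = a /\ b' = b) \/
          [/\ a' = - a, b' = - b & forall p, p \in Q -> (p.1, - p.2) \in Q])].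
Proof.
move=> h_gt1 r_gt0 r_even.
have [QS hS] := exists_symmetric_pattern h r_gt0 r_even.
have [QT hT] := prescribed_classes h.*2 r_gt0.
exists (maxn QS QT) => F N W DK DH; rewrite gtn_max => /andP[QSF QTF] Nr N4.
move=> [_ DKk DKu] desH rh; have [_ DHh DHu] := desH.
have [N_gt0 _] := finField_factors_gt0 Nr.
have N_even : ~~ odd N by move: N4 => /dvdnP[t ->]; rewrite oddM andbF.
have q_even : ~~ odd #|F|.-1 by rewrite -Nr oddM negb_and N_even.
have [w wP] := finField_prim_root_div Nr.
pose star x := enum [set A in DH | x \in A].
have star_size x : size (star x) = r.
  rewrite -cardE; have := design_replication x desH.
  by rewrite -rh => /eqP; rewrite eqn_pmul2r -?subn1 ?subn_gt0 // => /eqP.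
have mem_star x A : (A \in star x) = (A \in DH) && (x \in A) by rewrite mem_enum inE.
have symA A : exists a : W -> F, A \in DH ->
    (forall x, x \in A -> a x ^+ N = w ^+ index A (star x)) /\
    forall x y, x \in A -> y \in A -> x != y ->
      [/\ a x - a y != 0, a x + a y != 0 & (a x - a y) ^+ N != (a x + a y) ^+ N].
  have [AD|] := boolP (A \in DH); last by exists (fun=> 0).
  have [||a [a1 a2]] := hS F N W A (fun x => w ^+ index A (star x)) QSF Nr N4.
  - by rewrite (DHh A AD).
  - by move=> x _; rewrite -exprM mulnC exprM (prim_expr_order wP) expr1n.
  by exists a.
have [a aP] := fin_all_exists symA.
have aN A x : A \in DH -> x \in A -> a A x ^+ N = w ^+ index A (star x).
  by move=> AD; have [+ _] := aP A AD; apply.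
have aD A x y : A \in DH -> x \in A -> y \in A -> x != y ->
  [/\ a A x - a A y != 0, a A x + a A y != 0 &
      (a A x - a A y) ^+ N != (a A x + a A y) ^+ N].
  by move=> AD; have [_ +] := aP A AD; apply.
have w0 := prim_root_neq0 wP.
have a0 A x : A \in DH -> x \in A -> a A x != 0.
  move=> AD xA; have : a A x ^+ N != 0 by rewrite aN // expf_neq0.
  by rewrite expf_eq0 N_gt0.
(* Classes of the pair [x], [y] left over by the symmetric patterns. *)
pose R x y := [set z : F | (z ^+ r == 1) && ~~ [exists A in DH,
  [&& x \in A, y \in A & (z == (a A x - a A y) ^+ N) || (z == (a A x + a A y) ^+ N)]]].
have R_sym x y : R x y = R y x.
  apply/setP=> z; rewrite !inE; congr (_ && ~~ _); apply: eq_existsb => A.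
  rewrite -opprB even_exprN // [a A x + _]addrC; congr (_ && _); exact: andbCA.
have expNr (z : F) : z != 0 -> (z ^+ N) ^+ r = 1.
  by move=> z0; rewrite -exprM Nr finField_expfE.
have R_card x y : x != y -> #|R x y| = (r - 2)%N.
  move=> xy; have [A [[AD xA yA] Au]] := DHu x y xy.
  have [n1 n2 n3] := aD A x y AD xA yA xy.
  have -> : R x y = [set z : F | z ^+ r == 1] :\: [set (a A x - a A y) ^+ N; (a A x + a A y) ^+ N].
    apply/setP=> z; rewrite !inE andbC; congr (~~ _ && _).
    apply/existsP/idP => [[B /and4P[BD xB yB]]|zE]; first by rewrite -(Au B).
    by exists A; rewrite AD xA yA.
  rewrite cardsD (setIidPr _) ?cards2 ?n3 ?(prim_root_card wP) //.
  by apply/subsetP => _ /set2P[]->; rewrite inE expNr.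
have graphK (Kt : {set W} * 'I_(r - 2)) : exists al : W -> F, Kt.1 \in DK ->
    forall x y, x \in Kt.1 -> y \in Kt.1 -> x != y ->
      (al x - al y) ^+ N = nth 1 (enum (R x y)) Kt.2.
  case: Kt => K t /=; have [KD|] := boolP (K \in DK); last by exists (fun=> 0).
  have [||||al [_ alP]] := hT F N W K (fun=> setT)
    (fun x y => nth 1 (enum (R x y)) t) QTF Nr N_even.
  - by rewrite (DKk K KD).
  - by move=> x _; rewrite cardsT; apply: leq_trans (leq_pred _); rewrite -Nr leq_pmulr.
  - move=> x y _ _ xy; have : nth 1 (enum (R x y)) t \in enum (R x y).
      by rewrite mem_nth // -cardE R_card.
    by rewrite mem_enum inE => /andP[/eqP].
  - by move=> x y; rewrite R_sym.
  by exists al.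
have [al alP] := fin_all_exists graphK.
pose PQ : {set {set W * F}} := [set sym_pattern A (a A) | A in DH] :|:
  [set graph_pattern z.1 (al z) | z in setX DK setT].
have PQP Q : Q \in PQ -> (exists2 A, A \in DH & Q = sym_pattern A (a A)) \/
    (exists K t, K \in DK /\ Q = graph_pattern K (al (K, t))).
  case/setUP=> /imsetP[]; first by move=> A AD ->; left; exists A.
  by move=> [K t]; rewrite inE => /andP[KD _] ->; right; exists K, t.
have two_neq (s t : bool) A x : A \in DH -> x \in A ->
    (-1) ^+ s * a A x = (-1) ^+ t * a A x -> s = t.
  move=> AD xA /(mulIf (a0 A x AD xA)); have := finField_oppr_neq q_even (oner_neq0 F).
  case: s t => [] [] //=; rewrite expr0 expr1; first by move=> /eqP/[apply].
  by rewrite eq_sym => /eqP/[apply].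
have sym_inj A x y s t : A \in DH -> x \in A -> y \in A ->
    (-1) ^+ (s : bool) * a A x = (-1) ^+ (t : bool) * a A y -> x = y.
  move=> AD xA yA E; apply/eqP/negPn/negP => xy.
  have [n1 n2 _] := aD A x y AD xA yA xy.
  have := signed_diff_expr s t (a A x) (a A y) N_even.
  rewrite E subrr expr0n gtn_eqF //; case: ifP => _ /esym/eqP; rewrite expf_eq0 N_gt0 /=.
    by rewrite (negPf n1).
  by rewrite (negPf n2).
have two0 : 2 != 0 :> F.
  have := finField_oppr_neq q_even (oner_neq0 F).
  by apply: contraNneq => two0; rewrite eq_sym -subr_eq0 opprK -[_ + _]/(2%:R) two0.
exists PQ; split.
- move=> Q /PQP[[A AD ->]|[K [t [KD ->]]]].
    rewrite card_in_imset ?cardsX ?cardsT ?card_bool ?DHh ?muln2 //.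
    move=> [x s] [y t] /=; rewrite !inE !andbT /= => xA yA [xy].
    by rewrite xy in xA *; move=> /(two_neq _ _ _ _ AD xA) ->.
  by rewrite card_imset ?DKk // => x y [].
- move=> Q [x b] [y c] /PQP[[A AD ->]|[K [t [KD ->]]]] /=.
    move=> /mem_sym_pattern[xA [s ->]] /mem_sym_pattern[yA [t ->]] E.
    by rewrite E (sym_inj _ _ _ _ _ AD xA yA E).
  move=> /mem_graph_pattern[xK ->] /mem_graph_pattern[yK ->] E; rewrite E; congr (_, _).
  apply/eqP/negPn/negP => xy; have := alP (K, t) KD x y xK yK xy.
  rewrite E subrr expr0n gtn_eqF //= => /esym Z.
  have : nth 1 (enum (R x y)) t \in enum (R x y) by rewrite mem_nth // -cardE R_card.
  by rewrite Z mem_enum inE expr0n gtn_eqF //= eq_sym oner_eq0.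
- move=> x y z zr; have [<-|xy] := eqVneq x y.
    have zr' : (z / 2 ^+ N) ^+ r = 1 by rewrite exprMn zr exprVn expNr // invr1 mulr1.
    have [m mE] := prim_rootP wP zr'.
    have : nth set0 (star x) m \in star x by rewrite mem_nth ?star_size.
    set A := nth _ _ _; rewrite mem_star => /andP[AD xA].
    exists (sym_pattern A (a A)), ((-1) ^+ true * a A x), ((-1) ^+ false * a A x); split.
    + by apply/setUP; left; apply/imsetP; exists A.
    + by apply/mem_sym_pattern; split=> //; exists true.
    + by apply/mem_sym_pattern; split=> //; exists false.
    rewrite signed_diff_expr //= -mulr2n -mulr_natl exprMn aN // /A.
    by rewrite index_uniq ?star_size ?enum_uniq // -mE mulrC divfK // expf_neq0.
  have [A [[AD xA yA] Au]] := DHu x y xy.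
  have [K [[KD xK yK] Ku]] := DKu x y xy.
  have symPQ : sym_pattern A (a A) \in PQ.
    by apply/setUP; left; apply/imsetP; exists A.
  have [zR|] := boolP (z \in R x y).
    have lt_t : (index z (enum (R x y)) < r - 2)%N.
      by rewrite -(R_card x y xy) cardE index_mem mem_enum.
    pose t := Ordinal lt_t.
    exists (graph_pattern K (al (K, t))), (al (K, t) x), (al (K, t) y); split.
    + apply/setUP; right; apply/imsetP; exists (K, t) => //.
      by rewrite inE KD inE.
    + exact/mem_graph_pattern.
    + exact/mem_graph_pattern.
    rewrite (alP (K, t) KD) // 1?eq_sym // R_sym nth_index // mem_enum //.
  rewrite inE zr eqxx negbK /= => /existsP[B /and4P[BD xB yB]].
  rewrite -(Au B) // => /orP[]/eqP zE.
    exists (sym_pattern A (a A)), ((-1) ^+ false * a A x), ((-1) ^+ false * a A y); split=> //.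
    + by apply/mem_sym_pattern; split=> //; exists false.
    + by apply/mem_sym_pattern; split=> //; exists false.
    by rewrite signed_diff_expr.
  exists (sym_pattern A (a A)), ((-1) ^+ true * a A x), ((-1) ^+ false * a A y); split=> //.
  + by apply/mem_sym_pattern; split=> //; exists true.
  + by apply/mem_sym_pattern; split=> //; exists false.
  by rewrite signed_diff_expr.
have sym_notR A x y s t : A \in DH -> x \in A -> y \in A ->
    ((-1) ^+ (t : bool) * a A y - (-1) ^+ (s : bool) * a A x) ^+ N \notin R x y.
  move=> AD xA yA; rewrite inE negb_and negbK; apply/orP; right; apply/existsP.
  by exists A; rewrite AD xA yA signed_diff_expr //; case: ifP; rewrite eqxx ?orbT.
have graph_R K t x y : K \in DK -> x \in K -> y \in K -> x != y ->
    (al (K, t) y - al (K, t) x) ^+ N \in R x y /\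
    index ((al (K, t) y - al (K, t) x) ^+ N) (enum (R x y)) = t.
  move=> KD xK yK xy; have szR : (t < size (enum (R x y)))%N by rewrite -cardE R_card.
  rewrite (alP (K, t) KD) // 1?eq_sym // R_sym; split.
    by rewrite -mem_enum mem_nth.
  by rewrite index_uniq ?enum_uniq.
move=> x y Q b c Q' b' c' QP Q'P Qb Qc Q'b Q'c E cb.
have cb' : c' != b'.
  apply: contra_neq cb => cb'; apply/eqP; rewrite -subr_eq0.
  by move/eqP: E; rewrite cb' subrr expr0n gtn_eqF // expf_eq0 N_gt0.
have graph_neq K t u v : (x, u) \in graph_pattern K (al (K, t)) ->
    (y, v) \in graph_pattern K (al (K, t)) -> v != u -> x != y.
  by move=> /mem_graph_pattern[_ ->] /mem_graph_pattern[_ ->]; apply: contraNneq => ->.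
have [[A AD QE]|[K [t [KD QE]]]] := PQP _ QP; have [[A' A'D Q'E]|[K' [t' [K'D Q'E]]]] := PQP _ Q'P;
  rewrite {}QE in QP Qb Qc *; rewrite {}Q'E in Q'P Q'b Q'c *.
- move: Qb Qc Q'b Q'c E cb cb'.
  move=> /mem_sym_pattern[xA [s ->]] /mem_sym_pattern[yA [t ->]].
  move=> /mem_sym_pattern[xA' [s' ->]] /mem_sym_pattern[yA' [t' ->]].
  rewrite !signed_diff_expr // => E cb cb'.
  have [AA' st] : A' = A /\ (s == t) = (s' == t').
    have [xy|xy] := eqVneq x y; last first.
      have [B [_ Bu]] := DHu x y xy.
      have AA' : A' = A by rewrite -(Bu A) // -(Bu A').
      split=> //; have [_ _ n3] := aD A x y AD xA yA xy.
      rewrite AA' in E; move: E.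
      by do 2!case: ifP => _; move=> // E'; rewrite E' eqxx in n3.
    rewrite -xy in yA yA' E cb cb' *.
    have st : (s == t) = false by apply: contra_neqF cb => /eqP->.
    have st' : (s' == t') = false by apply: contra_neqF cb' => /eqP->.
    rewrite st st' in E *; split=> //; move: E.
    have dbl (u : F) : (u + u) ^+ N = 2 ^+ N * u ^+ N.
      by rewrite -exprMn mulr_natl mulr2n.
    rewrite (dbl (a A x)) (dbl (a A' x)) !aN // => /(mulfI (expf_neq0 N two0)) E.
    have idx B : B \in DH -> x \in B -> (index B (star x) < r)%N.
      by move=> BD xB; rewrite -(star_size x) index_mem mem_star BD.
    move/eqP: E; rewrite (eq_prim_root_expr wP) !modn_small ?idx // => /eqP E.
    rewrite -(nth_index set0 (_ : A' \in star x)) ?mem_star ?A'D // -E nth_index //.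
    by rewrite mem_star AD.
  rewrite AA'; split=> //; have [ss'|ss'] := eqVneq s' s.
    left; split; first by rewrite ss'.
    congr (_ ^+ _ * _); move: st; by rewrite ss'; case: s t t' {cb cb' E ss'} => [] [] [].
  right; split; last exact: sym_pattern_opp.
    by rewrite -mulNr -signrN; congr (_ ^+ _ * _); move: ss'; case: s s' {cb cb' E st} => [] [].
  rewrite -mulNr -signrN; congr (_ ^+ _ * _).
  by move: st ss'; case: s s' t t' {cb cb' E} => [] [] [] [].
- have xy := graph_neq _ _ _ _ Q'b Q'c cb'.
  move: Qb Qc Q'b Q'c E => /mem_sym_pattern[xA [s ->]] /mem_sym_pattern[yA [t ->]].
  move=> /mem_graph_pattern[xK ->] /mem_graph_pattern[yK ->] E.
  have := sym_notR A x y s t AD xA yA; rewrite E.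
  by have [-> _] := graph_R K' t' x y K'D xK yK xy.
- have xy := graph_neq _ _ _ _ Qb Qc cb.
  move: Qb Qc Q'b Q'c E => /mem_graph_pattern[xK ->] /mem_graph_pattern[yK ->].
  move=> /mem_sym_pattern[xA [s ->]] /mem_sym_pattern[yA [u ->]] E.
  have := sym_notR A' x y s u A'D xA yA; rewrite -E.
  by have [-> _] := graph_R K t x y KD xK yK xy.
have xy := graph_neq _ _ _ _ Qb Qc cb.
move: Qb Qc Q'b Q'c E => /mem_graph_pattern[xK ->] /mem_graph_pattern[yK ->].
move=> /mem_graph_pattern[xK' ->] /mem_graph_pattern[yK' ->] E.
have [B [_ Bu]] := DKu x y xy.
have KK' : K' = K by rewrite -(Bu K) // -(Bu K').
rewrite KK' in E xK' yK' *.
have [_ t1] := graph_R K t x y KD xK yK xy; have [_ t2] := graph_R K t' x y KD xK yK xy.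
have tt' : t' = t by apply: val_inj; rewrite /= -t1 -t2 E.
by rewrite tt'; split=> //; left.
Qed.

(** * The group action *)

(* If [l r = m (r g)] with [r != 0] then [(m / l) ^ #|gT| = 1], so [l] and [m] are
   in the same class because [#|gT|] divides [N]. *)
Lemma exists_invariant_class (F : finFieldType) (V : finLmodType F)
    (gT : finGroupType) (act : V -> gT -> V) N :
  (forall v, act v 1%g = v) ->
  (forall v g h, act (act v g) h = act v (g * h)%g) ->
  (forall l v g, act (l *: v) g = l *: act v g) ->
  (#|gT| %| N)%N ->
  exists ka : V -> F,
    [/\ forall d, d != 0 -> exists2 l, l != 0 & ka d = l ^+ N,
        forall l d, l != 0 -> d != 0 -> ka (l *: d) = l ^+ N * ka d
      & forall d g, d != 0 -> ka (act d g) = ka d].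
Proof.
move=> act1 actM actZ gN.
have act00 g : act 0 g = 0 by rewrite -{1}(scale0r 0) actZ scale0r.
pose eqv d d' := [exists l, exists g, (l != 0) && (d' == l *: act d g)].
have eqvP d d' : reflect (exists l g, l != 0 /\ d' = l *: act d g) (eqv d d').
  apply: (iffP existsP) => [[l /existsP[g /andP[l0 /eqP->]]]|[l [g [l0 ->]]]].
    by exists l, g.
  by exists l; apply/existsP; exists g; rewrite l0 /=.
have eqv_refl d : eqv d d.
  by apply/eqvP; exists 1, 1%g; rewrite oner_eq0 act1 scale1r.
have eqv_sym d d' : eqv d d' -> eqv d' d.
  case/eqvP=> l [g [l0 ->]]; apply/eqvP; exists l^-1, g^-1%g.
  by rewrite invr_eq0 l0 actZ scalerA mulVf // scale1r actM mulgV act1.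
have eqv_trans d1 d2 d3 : eqv d1 d2 -> eqv d2 d3 -> eqv d1 d3.
  case/eqvP=> l [g [l0 ->]] /eqvP[m [h [m0 ->]]]; apply/eqvP; exists (m * l), (g * h)%g.
  by rewrite mulf_neq0 // actZ scalerA actM.
pose rho d := odflt d [pick d' | eqv d d'].
have rhoE d d' : eqv d d' -> rho d' = rho d.
  move=> dd'; rewrite /rho (eq_pick (_ : eqv d' =1 eqv d)).
    by case: pickP => // /(_ d); rewrite eqv_refl.
  move=> x; apply/idP/idP; first exact: eqv_trans.
  by apply: eqv_trans; exact: eqv_sym.
have rho_eqv d : eqv (rho d) d.
  apply: eqv_sym; rewrite /rho; case: pickP => //=.
pose ka d := odflt 1 (omap (fun m => m ^+ N)
  [pick l | (l != 0) && [exists g, d == l *: act (rho d) g]]).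
have rho0 d : d != 0 -> rho d != 0.
  move=> d0; have /eqvP[l [g [_ dE]]] := rho_eqv d.
  apply: contraNneq d0 => r0; by rewrite dE r0 act00 scaler0.
have power r l m g h : r != 0 -> l != 0 -> m != 0 ->
    l *: act r g = m *: act r h -> l ^+ N = m ^+ N.
  move=> r0 l0 m0 E; pose x := (g * h^-1)%g; pose mu := l^-1 * m.
  have rx : act r x = mu *: r.
    have := congr1 (fun v => l^-1 *: act v h^-1%g) E.
    by rewrite !actZ !actM mulgV act1 !scalerA mulVf // scale1r.
  have rxn n : act r (x ^+ n)%g = mu ^+ n *: r.
    elim: n => [|n IHn]; first by rewrite expg0 act1 expr0 scale1r.
    by rewrite expgS -actM rx actZ IHn scalerA exprS.
  have /dvdnP[t NE] : (#[x]%g %| N)%N.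
    by apply: dvdn_trans gN; rewrite -cardsT order_dvdG ?inE.
  have : (mu ^+ N - 1) *: r == 0.
    by rewrite scalerBl -rxn NE mulnC expgM expg_order expg1n act1 scale1r subrr.
  rewrite scaler_eq0 (negPf r0) orbF subr_eq0 exprMn exprVn => /eqP muN.
  by rewrite -[LHS]mulr1 -muN mulVKf // expf_neq0.
have kaE d l g : d != 0 -> l != 0 -> d = l *: act (rho d) g -> ka d = l ^+ N.
  move=> d0 l0 dE; rewrite /ka; case: pickP => [m /andP[m0 /existsP[h /eqP dE']]|/(_ l)] /=.
    exact: power (rho0 d d0) m0 l0 (etrans (esym dE') dE).
  by rewrite l0 => /existsP[]; exists g; apply/eqP.
have act0 g d : d != 0 -> act d g != 0.
  move=> d0; apply: contraNneq d0 => E.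
  by rewrite -(act1 d) -(mulgV g) -actM E act00.
exists ka; split.
- move=> d d0; have /eqvP[l [g [l0 dE]]] := rho_eqv d.
  by exists l => //; apply: kaE dE.
- move=> m d m0 d0; have /eqvP[l [g [l0 dE]]] := rho_eqv d.
  have rE : rho (m *: d) = rho d.
    by apply: rhoE; apply/eqvP; exists m, 1%g; rewrite act1.
  rewrite (kaE d l g) // -exprMn; apply: (kaE _ _ g); rewrite ?mulf_neq0 //.
    by rewrite scaler_eq0 negb_or m0.
  by rewrite rE -scalerA -dE.
move=> d h d0; have /eqvP[l [g [l0 dE]]] := rho_eqv d.
have rE : rho (act d h) = rho d.
  by apply: rhoE; apply/eqvP; exists 1, h; rewrite oner_eq0 scale1r.
rewrite (kaE d l g) //; apply: (kaE _ _ (g * h)%g) => //; first exact: act0.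
by rewrite rE -actM -actZ -dE.
Qed.

Definition shift (F : finFieldType) (gT : finGroupType) (v : 'rV[F]_#|gT|) (g : gT) :
  'rV[F]_#|gT| := \row_j v 0 (enum_rank (g * enum_val j)%g).

Lemma shift1 (F : finFieldType) (gT : finGroupType) (v : 'rV[F]_#|gT|) : shift v 1 = v.
Proof. by apply/rowP=> j; rewrite mxE mul1g enum_valK. Qed.

Lemma shiftM (F : finFieldType) (gT : finGroupType) (v : 'rV[F]_#|gT|) g h :
  shift (shift v g) h = shift v (g * h)%g.
Proof. by apply/rowP=> j; rewrite !mxE enum_rankK mulgA. Qed.

Lemma shiftD (F : finFieldType) (gT : finGroupType) (u v : 'rV[F]_#|gT|) g :
  shift (u + v) g = shift u g + shift v g.
Proof. by apply/rowP=> j; rewrite !mxE. Qed.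

Lemma shift0 (F : finFieldType) (gT : finGroupType) g :
  shift (0 : 'rV[F]_#|gT|) g = 0.
Proof. by apply/rowP=> j; rewrite !mxE. Qed.

Lemma shiftZ (F : finFieldType) (gT : finGroupType) (l : F) (v : 'rV[F]_#|gT|) g :
  shift (l *: v) g = l *: shift v g.
Proof. by apply/rowP=> j; rewrite !mxE. Qed.

Lemma shift_faithful (F : finFieldType) (gT : finGroupType) (g h : gT) :
  (forall v : 'rV[F]_#|gT|, shift v g = shift v h) -> g = h.
Proof.
pose v : 'rV[F]_#|gT| := \row_j (enum_val j == 1%g)%:R.
move/(_ v)/rowP/(_ (enum_rank g^-1%g)); rewrite !mxE !enum_rankK mulgV eqxx.
case: eqP => [/eqP|_ /eqP]; last by rewrite oner_eq0.
by rewrite -eq_mulgV1 => /eqP.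
Qed.

Lemma blowup_aut_group (F : finFieldType) (gT : finGroupType) (W : finType) (x0 : W)
    (D : {set {set W}}) (PQ : {set {set W * F}}) (P : {set 'rV[F]_#|gT|})
    (G : {group gT}) :
  (forall d g, d \in P -> shift d g \in P) ->
  exists H : {group {perm W * 'rV[F]_#|gT|}},
    H \subset design_aut (blowup D PQ P) /\ G \isog H.
Proof.
move=> PG; pose V := 'rV[F]_#|gT|.
pose act (p : W * V) (g : gT) := (p.1, shift p.2 g).
have act1 p : act p 1%g = p by rewrite /act shift1; case: p.
have actM p : act_morph act p by move=> g h; rewrite /act shiftM.
pose to := TotalAction act1 actM.
exists (actperm to @* G)%G; split; last first.
  apply: sub_isog; first exact: subsetT.
  apply/injmP => g h _ _ E; apply: (@shift_faithful F) => v.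
  by have := congr1 (fun s : {perm W * V} => (s (x0, v)).2) E; rewrite !permE.
apply/subsetP => _ /morphimP[g _ _ ->]; rewrite inE eqEcard.
rewrite card_imset ?leqnn ?andbT; last exact/imset_inj/perm_inj.
have toE p : actperm to g p = (p.1, shift p.2 g) by rewrite permE.
apply/subsetP => _ /imsetP[b + ->] => /blowupP[[K KD [u ->]]|[Q [s [d [QP dP ->]]]]];
    apply/blowupP; [left|right].
  exists K => //; exists (shift u g); rewrite /flat_block -imset_comp.
  by apply: eq_imset => x /=; rewrite toE.
exists Q, (shift s g), (shift d g); split; rewrite ?PG //.
rewrite /pattern_block -imset_comp; apply: eq_imset => x /=.
by rewrite toE /= shiftD shiftZ.
Qed.

Lemma exists_two_designs h : (1 < h)%N -> exists (W : finType) (DK DH : {set {set W}}) r,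
  [/\ (0 < #|W|)%N, is_design #|W| h.*2 DK, is_design #|W| h DH &
      [/\ (0 < r)%N, ~~ odd r & (r * h.-1 = #|W|.-1)%N]].
Proof.
move=> h1; have k1 : (1 < h.*2)%N by lia.
have [QK hK] := exists_steiner k1; have [QH hH] := exists_steiner h1.
pose m := (h.*2 * (h.*2).-1 * (h * h.-1))%N.
have m_gt0 : (0 < m)%N by rewrite !muln_gt0; lia.
have [F [QF /dvdnP[t mF]]] := finField_exists (maxn QK QH) m_gt0.
move: QF; rewrite gtn_max => /andP[QKF QHF].
have dvdK : (h.*2 * (h.*2).-1 %| #|F|.-1)%N by rewrite mF /m dvdn_mull // dvdn_mulr.
have dvdH : (h * h.-1 %| #|F|.-1)%N by rewrite mF /m mulnA dvdn_mull.
have [DK desK] := hK F QKF dvdK; have [DH desH] := hH F QHF dvdH.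
exists (unit * F)%type, DK, DH, (t * (h.*2 * (h.*2).-1 * h))%N.
have -> : #|{: unit * F}| = #|F| by rewrite card_prod card_unit mul1n.
split=> //; first exact: ltnW (finNzRing_gt1 F).
split; last by rewrite mF /m !mulnA.
  have := finField_pred_gt0 F.
  by rewrite mF /m [(_ * (h * _))%N]mulnA mulnA muln_gt0 => /andP[].
by rewrite !oddM odd_double /= andbF.
Qed.

Lemma exists_design_with_group (h n : nat) (gT : finGroupType) (G : {group gT}) :
  (1 < h)%N -> exists v : nat, (n < v)%N /\
    exists (T : finType) (B : {set {set T}}), is_design v h.*2 B /\
      exists H : {group {perm T}}, H \subset design_aut B /\ G \isog H.
Proof.
move=> h1.
have [W [DK [DH [r [W0 desK desH [r0 r_even rW]]]]]] := exists_two_designs h1.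
have [Q0 hQ] := exists_patterns h1 r0 r_even.
have G0 : (0 < #|gT|)%N by rewrite -cardsT cardG_gt0.
have m0 : (0 < 4 * #|gT| * r)%N by rewrite !muln_gt0 G0.
have [F [qF /dvdnP[t tE]]] := finField_exists (maxn Q0 n) m0.
move: qF; rewrite gtn_max => /andP[QF nF].
pose N := (t * (4 * #|gT|))%N.
have Nr : (N * r)%N = #|F|.-1 by rewrite tE /N !mulnA.
have N4 : (4 %| N)%N by rewrite dvdn_mull // dvdn_mulr.
have NG : (#|gT| %| N)%N by rewrite dvdn_mull // dvdn_mull.
have [N_gt0 _] := finField_factors_gt0 Nr.
have [PQ [PQk PQinj PQex PQuniq]] := hQ F N W DK DH QF Nr N4 desK desH rW.
pose V := 'rV[F]_#|gT|.
have [ka [kaN kaZ kaG]] := @exists_invariant_class F V gT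
  (@shift F gT) N (@shift1 F gT) (@shiftM F gT) (@shiftZ F gT) NG.
pose P : {set V} := [set d | (d != 0) && (ka d == 1)].
exists (#|W| * #|{: V}|)%N; split.
  rewrite card_mx mul1n; apply: leq_trans nF _.
  apply: leq_trans (leq_pmull _ W0); rewrite -[leqLHS]expn1 leq_pexp2l //.
  exact: ltnW (finNzRing_gt1 F).
exists (W * V)%type, (blowup DK PQ P); split; last first.
  have [x0 _] : exists x : W, x \in predT by apply/card_gt0P.
  apply: blowup_aut_group => // d g; rewrite !inE => /andP[d0 kd].
  rewrite kaG // kd andbT; apply: contraNneq d0 => E.
  by rewrite -(shift1 d) -(mulgV g) -shiftM E shift0.
have ka0 d : d != 0 -> ka d != 0.
  by move=> d0; have [l l0 ->] := kaN d d0; rewrite expf_neq0.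
have inP (de : V) l : l^-1 *: de \in P -> l != 0 /\ l ^+ N = ka de.
  rewrite inE => /andP[de0 /eqP kde].
  have l0 : l != 0 by apply: contraNneq de0 => ->; rewrite invr0 scale0r.
  split=> //; rewrite -[de in RHS](scale1r de) -(divff l0) -scalerA kaZ //.
  by rewrite kde mulr1.
apply: blowup_design => //.
- by rewrite inE eqxx.
- move=> x y de de0; have [l l0 kl] := kaN de de0.
  have [|Q [a [b [QP Qa Qb E]]]] := PQex x y (ka de).
    by rewrite kl -exprM Nr finField_expfE.
  exists Q, a, b; split=> //.
  have ba : b - a != 0.
    by apply: contraNneq (ka0 de de0) => ba; rewrite -E ba expr0n gtn_eqF.
  rewrite inE scaler_eq0 invr_eq0 negb_or ba de0 /=.
  by rewrite kaZ ?invr_eq0 // exprVn E mulVf // ka0.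
move=> x y de Q a b Q' a' b' QP Q'P Qa Qb Q'a Q'b /inP[ba E] /inP[_ E'].
apply: (PQuniq x y) => //; first by rewrite E E'.
by rewrite -subr_eq0.
Qed.

Close Scope ring_scope.

Theorem theorem1p3 (k : nat) (gT : finGroupType) (G : {group gT})
    (k_ge4 : 4 <= k) (k_even : ~~ odd k) (G_even : ~~ odd #|G|)
    (G_primes : forall p e : nat, prime p -> 0 < e -> p ^ e %| #|G| ->
       p ^ e %| k \/ coprime (p ^ e) (k * (k - 1))) :
  forall n : nat, exists v : nat, n < v /\
    exists (T : finType) (B : {set {set T}}),
      is_design v k B /\
      exists H : {group {perm T}}, H \subset design_aut B /\ G \isog H.
Proof.
move=> n; rewrite -(even_halfK k_even); apply: exists_design_with_group.
by rewrite -ltn_double even_halfK // (leq_trans _ k_ge4).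
Qed.
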